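(* Let $(A_n)_{n\ge 0}$ be a sequence of complex numbers with $A(t)=\sum_{n\ge 0}A_n\frac{t^n}{n!}$, and let $a,b,c,x\in\mathbb{C}$ with $c\notin\{0,-1,-2,\dots\}$. Then the Gauss-Appell polynomials ${}_{{}_2F_1}A_n(a,b;c;x)=(x\hat\chi+\hat a)^n\phi_0\psi_0$ satisfy, as an identity of formal power series in $t$, $$\sum_{n=0}^{\infty}{}_{{}_2F_1}A_n(a,b;c;x)\frac{t^n}{n!}=A(t)\;{}_2F_1(a,b;c;xt).$$
   Context: $(r)_k=r(r+1)\cdots(r+k-1)$, $(r)_0=1$, is the Pochhammer symbol, and ${}_2F_1(a,b;c;z)=\sum_{k\ge 0}\frac{(a)_k(b)_k}{(c)_k}\frac{z^k}{k!}$, regarded as a formal power series in $z$. Umbral convention: $\hat\chi$ and $\hat a$ are commuting symbols. For a polynomial $P$ in $\hat\chi,\hat a$ with complex coefficients, $P\,\phi_0\psi_0$ denotes the complex number obtained by expanding $P$ in monomials and applying the linear functional determined by $\hat\chi^k\hat a^j\,\phi_0\psi_0=\frac{(a)_k(b)_k}{(c)_k}A_j$ for all $k,j\ge 0$. The Gauss-Appell polynomials associated with $A(t)$ are defined for $n\ge 0$ by ${}_{{}_2F_1}A_n(a,b;c;x)=(x\hat\chi+\hat a)^n\phi_0\psi_0$. *)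

(* Defs.v *)
From HB Require Import structures.
From mathcomp Require Import all_boot all_order all_algebra.
From mathcomp Require Import ssrcomplements mpoly.

Set Implicit Arguments.
Unset Strict Implicit.
Unset Printing Implicit Defensive.

Import GRing.Theory.
Local Open Scope ring_scope.

Section GaussAppell.

Variable F : fieldType.
Implicit Types (a b c x r : F) (A : nat -> F) (P Q : {mpoly F[2]}).

Definition pochhammer r (k : nat) : F := \prod_(i < k) (r + i%:R).

(* A formal power series in one variable is its sequence of coefficients:
   f n is the coefficient of t^n. *)
Definition fps : Type := nat -> F.

(* The Cauchy product. *)
Definition fps_mul (f g : fps) : fps :=
  fun n => \sum_(i < n.+1) f i * g (n - i)%N.

(* The substitution f(x t), as a series in t. *)
Definition fps_scale x (f : fps) : fps := fun n => f n * x ^+ n.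

(* The series \sum_n u_n t^n / n!. *)
Definition egf (u : nat -> F) : fps := fun n => u n / n`!%:R.

Definition hyp2F1 a b c : fps :=
  egf (fun k => pochhammer a k * pochhammer b k / pochhammer c k).

Definition chi_hat : {mpoly F[2]} := 'X_ord0.
Definition a_hat : {mpoly F[2]} := 'X_ord_max.

(* The number P phi_0 psi_0: the polynomial P is expanded in monomials, and
   chi_hat^k a_hat^j is sent to (a)_k (b)_k / (c)_k * A_j; see umbral_linear
   and umbral_monomial. *)
Definition umbral a b c A P : F :=
  \sum_(m <- msupp P)
    P@_m * (pochhammer a (m ord0) * pochhammer b (m ord0)
              / pochhammer c (m ord0) * A (m ord_max)).

Lemma umbral_linear a b c A : linear_for *%R (umbral a b c A).
Proof.
pose w (m : 'X_{1..2}) := pochhammer a (m ord0) * pochhammer b (m ord0)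
              / pochhammer c (m ord0) * A (m ord_max).
have E k P : (msize P <= k)%N ->
    umbral a b c A P = \sum_(m : 'X_{1..2 < k}) P@_m * w m.
  move=> lePk; pose I : subFinType _ := 'X_{1..2 < k}.
  rewrite /umbral (big_mksub I) //=; first last.
  - by move=> m /msize_mdeg_lt /leq_trans; apply.
  - by rewrite msupp_uniq.
  rewrite big_rmcond //= => m.
  by move/memN_msupp_eq0 ->; rewrite mul0r.
move=> d P Q; pose k := maxn (msize (d *: P + Q)) (maxn (msize P) (msize Q)).
rewrite !(E k) ?/k ?leq_max ?leqnn ?orbT // mulr_sumr -big_split /=.
by apply: eq_bigr => m _; rewrite mcoeffD mcoeffZ mulrDl -mulrA.
Qed.

Lemma umbral_monomial a b c A k j :
  umbral a b c A (chi_hat ^+ k * a_hat ^+ j)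
  = pochhammer a k * pochhammer b k / pochhammer c k * A j.
Proof.
rewrite /chi_hat /a_hat !mpolyXn -mpolyXD /umbral msuppX big_seq1.
by rewrite mcoeffX eqxx mul1r !mnmDE !mulmnE !mnm1E /= !mul1n !mul0n add0n addn0.
Qed.

(* The Gauss-Appell polynomial of index n, evaluated at x. *)
Definition gauss_appell a b c A x (n : nat) : F :=
  umbral a b c A ((x *: chi_hat + a_hat) ^+ n).

End GaussAppell.

(* Main.v *)
Require Import Defs.
From HB Require Import structures.
From mathcomp Require Import all_boot all_order all_algebra.
From mathcomp Require Import reals.
From mathcomp Require Import complex.
From mathcomp Require Import mpoly.

Import GRing.Theory Num.Theory.
Local Open Scope ring_scope.

(** Since the symbols commute, the binomial theorem expands the umbral power, and linearity
    evaluates it monomial by monomial ([gauss_appellE]). Dividing by [n!] splits the binomial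
    coefficient into [1/i!] and [1/(n-i)!] ([bin_div_fact]), which leaves the [n]-th coefficient of
    a Cauchy product. *)

HB.instance Definition _ (F : fieldType) (a b c : F) (A : nat -> F) :=
  GRing.isLinear.Build F {mpoly F[2]} F *%R (umbral a b c A)
    (umbral_linear a b c A).

Lemma gauss_appellE (F : fieldType) (a b c : F) (A : nat -> F) (x : F) (n : nat) :
  gauss_appell a b c A x n =
  \sum_(i < n.+1) (x ^+ (n - i) * (pochhammer a (n - i) * pochhammer b (n - i)
                     / pochhammer c (n - i) * A i)) *+ 'C(n, i).
Proof.
(* [exprDn] gives [a_hat] the exponent [i], so [i] indexes [A], the first factor of the Cauchy
   product. *)
rewrite /gauss_appell exprDn raddf_sum; apply: eq_bigr => i _ /=.
by rewrite raddfMn /= exprZn -scalerAl linearZ /= umbral_monomial.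
Qed.

(** In characteristic zero the binomial coefficient, a factor of [n!], is invertible and cancels. *)
Lemma bin_div_fact (F : numFieldType) (n i : nat) : (i <= n)%N ->
  'C(n, i)%:R / n`!%:R = (i`!%:R)^-1 / (n - i)`!%:R :> F.
Proof.
move=> le_in; rewrite -(bin_fact le_in) !natrM !invfM mulVKf //.
by rewrite pnatr_eq0 -lt0n bin_gt0.
Qed.

Lemma egf_gauss_appell (F : numFieldType) (a b c : F) (A : nat -> F) (x : F) :
  egf (gauss_appell a b c A x) =1 fps_mul (egf A) (fps_scale x (hyp2F1 a b c)).
Proof.
move=> n; rewrite /fps_mul /fps_scale /hyp2F1 /egf gauss_appellE mulr_suml.
apply: eq_bigr => i _; rewrite -mulr_natr -mulrA bin_div_fact -1?ltnS //.
(* [mulrACA] pairs [A i] with [1/i!] and the hypergeometric term with [1/(n-i)!]. *)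
by rewrite [x ^+ _ * _]mulrC [_ * A i]mulrC -[A i * _ * _]mulrA mulrACA [_ * x ^+ _ / _]mulrAC.
Qed.

Theorem mainTheorem1 (R : realType) (A : nat -> R[i]) (a b c x : R[i])
    (hc : forall k : nat, c <> - k%:R) :
  egf (gauss_appell a b c A x) =1 fps_mul (egf A) (fps_scale x (hyp2F1 a b c)).
Proof. exact: egf_gauss_appell. Qed.
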